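(* Let $G$ be a $\delta$-hyperbolic graph with $n$ vertices and $m$ edges. There exists an algorithm that finds a point $c\in A(G)$ that $(r_1+\delta)$-dominates $V(G)$, where $r_1$ is the $1$-radius of $V(G)$. This algorithm requires time $O((2\delta+1)(m+n))$.
   Context: Each edge of the finite undirected graph $G$ is a unit-length segment. $A(G)$ is the set of points of $G$, consisting of the vertices and the points on edges, and $d$ is the shortest-path distance on $A(G)$. A geodesic triangle $\Delta(x,y,z)$ is a union of shortest paths $[x,y],[y,z],[x,z]$, and $[x,y][t]$ is the point of $[x,y]$ at distance $t$ from $x$. Set $\pi=\frac12(d(x,y)+d(y,z)+d(x,z))$, $\alpha_x=\pi-d(y,z)$, $\alpha_y=\pi-d(x,z)$ and $\alpha_z=\pi-d(x,y)$. The insize of the triangle is the maximum over the three corners of $\max_{\theta\in[0,\alpha_x]} d([x,y][\theta],[x,z][\theta])$ and the analogous quantities at $y$ and $z$. $G$ is $\delta$-hyperbolic if all geodesic triangles have insize at most $\delta$, with $\delta$ the least such constant. A point $c$ $r$-dominates $V(G)$ if $d(v,c)\le r$ for all $v\in V(G)$. $r_1=\min_{c\in A(G)}\max_{v\in V(G)} d(v,c)$. *)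

(* Defs.v *)
From HB Require Import structures.
From mathcomp Require Import all_boot all_order all_algebra.
From mathcomp Require Import classical_sets reals.

Set Implicit Arguments.
Unset Strict Implicit.
Unset Printing Implicit Defensive.
Import Order.TTheory GRing.Theory Num.Theory.

Local Open Scope classical_set_scope.
Local Open Scope ring_scope.

Record sgraph (n : nat) := SGraph {
  edge :> rel 'I_n;
  edge_sym : symmetric edge;
  edge_irr : irreflexive edge }.

Definition connected n (G : sgraph n) : Prop :=
  (0 < n)%N /\ forall u v : 'I_n, connect G u v.

Definition num_edges n (G : sgraph n) : nat :=
  #|[set p : 'I_n * 'I_n | (p.1 < p.2)%N && G p.1 p.2]%SET|.

(* In a connected graph some walk from u to v has length less than n, so the
   search succeeds; the junk value n is only reached for disconnected u, v. *)
Definition vdist n (G : sgraph n) (u v : 'I_n) : nat :=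
  find (fun k => [exists p : k.-tuple 'I_n, path G u p && (last u p == v)])
       (iota 0 n).

(* The points of A(G), each with exactly one name: [Inner t H] is the point in
   the relative interior of the edge uv, u < v, at distance t from u. *)
Inductive gpoint (R : realType) n (G : sgraph n) : Type :=
| Vertex of 'I_n
| Inner (u v : 'I_n) (t : R) of
    [&& (u < v)%N, G u v, 0 < t & t < 1].
Arguments Vertex {R n G}.
Arguments Inner {R n G u v}.

Section Metric.
Context (R : realType) (n : nat) (G : sgraph n).
Implicit Types (x y z c : gpoint R G) (g : R -> gpoint R G).

Definition to_vertex x (w : 'I_n) : R :=
  match x with
  | Vertex u => (vdist G u w)%:R
  | @Inner _ _ _ u v t _ =>
      Num.min (t + (vdist G u w)%:R) (1 - t + (vdist G v w)%:R)
  end.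

(* A shortest path leaves the edge carrying y through one of its two ends,
   unless it is a segment of that edge. *)
Definition dist x y : R :=
  match y with
  | Vertex w => to_vertex x w
  | @Inner _ _ _ u v t _ =>
      let outside := Num.min (to_vertex x u + t) (to_vertex x v + (1 - t)) in
      match x with
      | @Inner _ _ _ u' v' t' _ =>
          if (u' == u) && (v' == v) then `|t' - t| else outside
      | Vertex _ => outside
      end
  end.

(* A shortest path [x,y], parametrized by the distance to x: [x,y][t] is g t.
   The values of g outside of `[0, dist x y] are irrelevant. *)
Definition shortest_path x y g : Prop :=
  [/\ g 0 = x, g (dist x y) = y &
      forall s t, 0 <= s <= dist x y -> 0 <= t <= dist x y ->
        dist (g s) (g t) = `|s - t|].

Definition half_perimeter x y z : R := (dist x y + dist y z + dist x z) / 2.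

(* The supremum is a maximum: for shortest paths p and q the distance is a
   continuous function of theta on a compact interval. *)
Definition corner_size (alpha : R) (p q : R -> gpoint R G) : R :=
  sup [set dist (p theta) (q theta) | theta in [set th | 0 <= th <= alpha]].

(* gxy, gyz, gxz are the sides [x,y], [y,z], [x,z]; the sides issued from y and
   z that are needed in the other direction are obtained by reversal. *)
Definition insize x y z (gxy gyz gxz : R -> gpoint R G) : R :=
  let pi := half_perimeter x y z in
  let gyx th := gxy (dist x y - th) in
  let gzy th := gyz (dist y z - th) in
  let gzx th := gxz (dist x z - th) in
  Num.max (corner_size (pi - dist y z) gxy gxz)
    (Num.max (corner_size (pi - dist x z) gyx gyz)
             (corner_size (pi - dist x y) gzx gzy)).

Definition insizes_at_most (delta : R) : Prop :=
  forall x y z gxy gyz gxz,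
    shortest_path x y gxy -> shortest_path y z gyz -> shortest_path x z gxz ->
    insize x y z gxy gyz gxz <= delta.

Definition hyperbolic (delta : R) : Prop :=
  insizes_at_most delta /\
  forall delta', insizes_at_most delta' -> delta <= delta'.

Definition dominates (r : R) c : Prop :=
  forall v : 'I_n, dist (Vertex v) c <= r.

(* The base value 0 is harmless because distances are nonnegative. *)
Definition ecc c : R := \big[Num.max/0]_(v < n) dist (Vertex v) c.

End Metric.

(* The infimum is a minimum: ecc is continuous and A(G) is compact. *)
Definition radius1 (R : realType) n (G : sgraph n) : R :=
  inf [set ecc c | c in [set: gpoint R G]].

(* Algorithms are structured programs for a random access machine with the
   uniform cost criterion. The memory consists of arrays of natural numbers; a
   program names its arrays by constants, so it uses a fixed number of them
   (they could be interleaved in one memory at the price of a constant factor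
   in time). Scalar variables are cells of arrays. The only arithmetic
   operations are + and truncated -, and every operation, memory access, test
   and assignment costs one time unit. *)
Inductive expr :=
| Const of nat
| Get (a : nat) of expr
| Add of expr & expr
| Sub of expr & expr.

Inductive com :=
| Skip
| Put (a : nat) of expr & expr
| Seq of com & com
| If of expr & com & com
| While of expr & com.

Definition store := nat -> nat -> nat.

Definition update (s : store) (a i k : nat) : store :=
  fun b j => if (b == a) && (j == i) then k else s b j.

Fixpoint eval (s : store) (e : expr) : nat :=
  match e with
  | Const k => k
  | Get a i => s a (eval s i)
  | Add e1 e2 => (eval s e1 + eval s e2)%N
  | Sub e1 e2 => (eval s e1 - eval s e2)%N
  end.

Fixpoint cost (e : expr) : nat :=
  match e with
  | Const _ => 1
  | Get _ i => (cost i).+1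
  | Add e1 e2 | Sub e1 e2 => (cost e1 + cost e2).+1
  end.

(* exec P s t s': started in s, the program P halts in s' after t time units.
   Tests succeed on nonzero values. *)
Inductive exec : com -> store -> nat -> store -> Prop :=
| exec_skip s : exec Skip s 1 s
| exec_put a i e s :
    exec (Put a i e) s (cost i + cost e).+1
         (update s a (eval s i) (eval s e))
| exec_seq P Q s1 s2 s3 t1 t2 :
    exec P s1 t1 s2 -> exec Q s2 t2 s3 -> exec (Seq P Q) s1 (t1 + t2) s3
| exec_if_true e P Q s s' t :
    eval s e != 0%N -> exec P s t s' -> exec (If e P Q) s (cost e + t).+1 s'
| exec_if_false e P Q s s' t :
    eval s e = 0%N -> exec Q s t s' -> exec (If e P Q) s (cost e + t).+1 s'
| exec_while_true e P s1 s2 s3 t1 t2 :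
    eval s1 e != 0%N -> exec P s1 t1 s2 -> exec (While e P) s2 t2 s3 ->
    exec (While e P) s1 (cost e + t1 + t2).+1 s3
| exec_while_false e P s :
    eval s e = 0%N -> exec (While e P) s (cost e).+1 s.

(* The neighbours of a vertex may be listed in any order. *)
Definition adjacency_lists n (G : sgraph n) (adj : 'I_n -> seq 'I_n) : Prop :=
  forall u, uniq (adj u) /\ adj u =i G u.

(* Array 0 holds n; array 2 holds the concatenation of the adjacency lists, the
   list of vertex i occupying the cells from index (array 1)[i] included to
   index (array 1)[i+1] excluded. All the other cells are 0. *)
Definition input n (adj : 'I_n -> seq 'I_n) : store := fun a i =>
  match a with
  | 0 => if i == 0%N then n else 0%N
  | 1 => if (i <= n)%N then (\sum_(v < n | (v < i)%N) size (adj v))%N else 0%N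
  | 2 => nth 0%N (flatten [seq map val (adj v) | v <- enum 'I_n]) i
  | _ => 0%N
  end.

(* The answer is read in array 3: cells 0 and 1 are equal for a vertex, and are
   the two ends u < v of the edge for an inner point, whose distance to u is the
   fraction with numerator in cell 2 and denominator in cell 3. *)
Definition outputs (R : realType) n (G : sgraph n) (s : store)
    (c : gpoint R G) : Prop :=
  match c with
  | Vertex v => s 3%N 0%N = v /\ s 3%N 1%N = v
  | @Inner _ _ _ u v t _ =>
      [/\ s 3%N 0%N = u, s 3%N 1%N = v &
          t = (s 3%N 2%N)%:R / (s 3%N 3%N)%:R]
  end.

(* Main.v *)
Require Import Defs.
From HB Require Import structures.
From mathcomp Require Import all_boot all_order all_algebra.
From mathcomp Require Import classical_sets reals.
From mathcomp Require Import zify ring lra.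
Set Implicit Arguments.
Unset Strict Implicit.
Unset Printing Implicit Defensive.
Import Order.TTheory GRing.Theory Num.Theory.
Local Open Scope ring_scope.

(* Let e(v) be the largest distance from a vertex v to a vertex. Starting from
   any v0, let v(i+1) be a vertex farthest from v(i), found by breadth-first
   search. The e(v(i)) are nondecreasing, and e(v1) >= diam - 2 delta: for
   vertices a, b with d(v1,b) <= d(v1,a), the points at distance d(v1,b)/2 from
   v1 on [v1,a] and [v1,b] are both delta-close to the one on [v1,v0], because
   d(v0,a) and d(v0,b) are at most d(v0,v1). So after O(delta + 1) searches
   e(v(i+1)) = e(v(i)), and then x = v(i) and y = v(i+1) are mutually farthest.
   The midpoint c of any shortest path [x,y] is the answer: if
   d(y,v) <= d(x,v), then c is delta-close to the point c' of [x,v] at distance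
   d(x,y)/2 from x, and d(c',v) = d(x,v) - d(x,y)/2 <= d(x,y)/2 <= r_1. *)

(** * Vertex distances *)

Section VertexDistance.
Local Open Scope nat_scope.
Context (n : nat) (G : sgraph n).
Implicit Types u v w : 'I_n.

(** This covers walks of any length: with at least [n] steps the bound holds because the search
    never returns more than [n]. *)
Lemma vdist_le_size u p : path G u p -> vdist G u (last u p) <= size p.
Proof.
move=> pth; rewrite /vdist; set f := (X in find X _).
have [lt_pn|le_np] := ltnP (size p) n; last first.
  by apply: leq_trans le_np; rewrite (leq_trans (find_size _ _)) ?size_iota.
rewrite leqNgt; apply/negP => lt_pf.
have := before_find 0 lt_pf; rewrite nth_iota // add0n /f => /existsP; apply.
by exists (in_tuple p); rewrite pth eqxx.
Qed.

Lemma vdist_leq_order u v : vdist G u v <= n.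
Proof. by rewrite (leq_trans (find_size _ _)) ?size_iota. Qed.

Hypothesis Gconn : connected G.

(** A walk without repeated vertices has fewer than [n] steps, so the search over lengths below [n]
    succeeds. *)
Lemma vdist_path u v :
  exists p, [/\ path G u p, last u p = v & size p = vdist G u v].
Proof.
have /connectP[p0 /shortenP[p pth Up _] ->] := Gconn.2 u v.
have lt_pn : size p < n.
  by have := max_card (mem (u :: p)); rewrite (card_uniqP Up) card_ord.
rewrite /vdist; set f := (X in find X _).
have hasf : has f (iota 0 n).
  apply/hasP; exists (size p); first by rewrite mem_iota.
  by rewrite /f /=; apply/existsP; exists (in_tuple p); rewrite pth eqxx.
have lt_fn : find f (iota 0 n) < n by rewrite -[X in _ < X](size_iota 0 n) -has_find.
have := nth_find 0 hasf; rewrite nth_iota // add0n /f.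
by case/existsP=> q /andP[qth /eqP lastq]; exists q; rewrite size_tuple.
Qed.

Lemma vdistxx u : vdist G u u = 0.
Proof. by have := @vdist_le_size u [::] isT; rewrite leqn0 => /eqP. Qed.

Lemma vdist_triangle v u w : vdist G u w <= vdist G u v + vdist G v w.
Proof.
have [p [pth lp <-]] := vdist_path u v; have [q [qth lq <-]] := vdist_path v w.
have := @vdist_le_size u (p ++ q).
by rewrite cat_path last_cat size_cat lp pth qth lq => /(_ isT).
Qed.

Lemma vdistC u v : vdist G u v = vdist G v u.
Proof.
suff le_sym x y : vdist G x y <= vdist G y x by apply/eqP; rewrite eqn_leq !le_sym.
have [p [pth lp <-]] := vdist_path y x.
have := @vdist_le_size x (rev (belast y p)).
rewrite size_rev size_belast -{1}lp rev_path.
rewrite (eq_path (e' := G)) => [|i j]; last by rewrite edge_sym.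
have -> : last x (rev (belast y p)) = y.
  by case: p {pth} lp => [|z p] //=; rewrite rev_cons last_rcons.
by apply.
Qed.

Lemma vdist_edge u v : G u v -> vdist G u v = 1.
Proof.
move=> Guv; apply/eqP; rewrite eqn_leq.
have -> /= : vdist G u v <= 1 by apply: (@vdist_le_size u [:: v]); rewrite /= Guv.
have [[|z p] [_ luv <-]] := vdist_path u v => //.
by move: Guv; rewrite -luv /= edge_irr.
Qed.

Lemma vdist_edge_r u v w : G u v -> vdist G w v <= vdist G w u + 1.
Proof.
by move=> Guv; rewrite -(vdist_edge Guv) vdist_triangle.
Qed.

End VertexDistance.

(** * The metric on A(G) *)

Section Points.
Context (R : realType) (n : nat) (G : sgraph n).
Hypothesis Gconn : connected G.
Implicit Types (u v w : 'I_n) (x y c : gpoint R G) (s t : R).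

Let vdist_trR u v w : (vdist G u w)%:R <= (vdist G u v)%:R + (vdist G v w)%:R :> R.
Proof. by rewrite -natrD ler_nat vdist_triangle. Qed.

(** [dist] is defined asymmetrically in its arguments; this exchange with a vertex is the symmetry
    that later steps use. *)
Lemma dist_Vertex v c : dist (Vertex v) c = to_vertex c v.
Proof.
case: c => [w|u w t H] /=; first by rewrite vdistC.
by rewrite ![vdist G v _]vdistC // ![t + _]addrC ![1 - t + _]addrC.
Qed.

Lemma to_vertex_vdist x u w :
  to_vertex x w <= to_vertex x u + (vdist G u w)%:R.
Proof.
case: x => [z|z z' t _] /=; first exact: vdist_trR.
rewrite addr_minl le_min !ge_min.
have := vdist_trR z u w; have := vdist_trR z' u w.
by move=> *; apply/andP; split; apply/orP; [left|right]; lra.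
Qed.

(** For two points of the same edge, [dist] compares positions. The detour through an end is not
    shorter, because the ends are at distance 1. *)
Lemma dist_le_outside x u v t (H : [&& (u < v)%N, G u v, 0 < t & t < 1]) :
  dist x (Inner t H) <= Num.min (to_vertex x u + t) (to_vertex x v + (1 - t)).
Proof.
case: x => [//|u' v' t' H'] /=; case: ifP => // /andP[/eqP eu /eqP ev].
move: H'; rewrite eu ev => /and4P[_ Guv t'_gt0 t'_lt1].
have /and4P[_ _ t_gt0 t_lt1] := H.
rewrite !vdistxx le_min.
rewrite !vdist_edge ?(edge_sym G v) // !addr_minl !le_min !ler_norml.
by do !(apply/andP; split); lra.
Qed.

(** The triangle inequality in the form used throughout, with a vertex as last point. If [c] is
    inside an edge, a route that enters by one end and leaves by the other traverses the whole edge,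
    whose length 1 bounds the distance of its ends. If [x] lies on the same edge, positions are
    compared directly. *)
Lemma to_vertex_triangle x c w : to_vertex x w <= dist x c + to_vertex c w.
Proof.
case: c => [u|u v t H]; first exact: to_vertex_vdist.
have Guv : G u v by case/and4P: (H).
have d_vu : (vdist G u w)%:R <= 1 + (vdist G v w)%:R :> R.
  by have := vdist_trR u v w; rewrite (vdist_edge Gconn Guv).
have d_uv : (vdist G v w)%:R <= 1 + (vdist G u w)%:R :> R.
  by have := vdist_trR v u w; rewrite (vdist_edge Gconn (v := u)) ?(edge_sym G v).
have out (o := Num.min (to_vertex x u + t) (to_vertex x v + (1 - t))) :
    to_vertex x w <= o + to_vertex (Inner t H) w.
  have := to_vertex_vdist x u w; have := to_vertex_vdist x v w.
  have /and4P[_ _ t_gt0 t_lt1] := H.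
  by move=> *; rewrite /o /= addr_minl !addr_minr !le_min; do !(apply/andP; split); lra.
case: x out => [//|u' v' t' H'] /=; case: ifP => // /andP[/eqP eu /eqP ev] _.
rewrite eu ev !addr_minr !le_min !ge_min.
have := ler_norm (t' - t); have := ler_norm (t - t'); rewrite (distrC t).
by move=> *; apply/andP; split; apply/orP; [left|right]; lra.
Qed.

(* The point of the edge uv at distance t from u, for 0 <= t < 1; the last
   [Vertex u] is a junk value. *)
Definition edge_point u v t : gpoint R G :=
  if t == 0 then Vertex u else
  match @idP [&& (u < v)%N, G u v, 0 < t & t < 1] with
  | ReflectT H => Inner t H
  | ReflectF _ =>
    match @idP [&& (v < u)%N, G v u, 0 < 1 - t & 1 - t < 1] with
    | ReflectT H => Inner (1 - t) H
    | ReflectF _ => Vertex u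
    end
  end.

Variant edge_point_spec u v t : gpoint R G -> Prop :=
| EdgePointVertex of t = 0 : edge_point_spec u v t (Vertex u)
| EdgePointInner (H : [&& (u < v)%N, G u v, 0 < t & t < 1]) :
    edge_point_spec u v t (Inner t H)
| EdgePointFlipped (H : [&& (v < u)%N, G v u, 0 < 1 - t & 1 - t < 1]) :
    edge_point_spec u v t (Inner (1 - t) H).

(** The last vertex of a walk has no next edge, so adjacency is demanded only for nonzero [t]. *)
Lemma edge_pointP u v t : 0 <= t < 1 -> t = 0 \/ G u v ->
  edge_point_spec u v t (edge_point u v t).
Proof.
move=> /andP[t_ge0 t_lt1] Guv; rewrite /edge_point; case: eqVneq => [->|t_neq0].
  exact: EdgePointVertex.
have t_gt0 : 0 < t by rewrite lt_neqAle eq_sym t_neq0.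
case: Guv => [t0|Guv]; first by rewrite t0 eqxx in t_neq0.
destruct idP as [H|nH]; first exact: EdgePointInner.
destruct idP as [H|nH']; first exact: EdgePointFlipped.
case: nH'; apply/and4P; split; [|by rewrite edge_sym|lra|lra].
case: (ltngtP u v) nH => //; first by move=> _; case; rewrite Guv t_gt0 t_lt1.
by move/val_inj => uv _; rewrite uv edge_irr in Guv.
Qed.

Lemma to_vertex_edge_point u v t w : 0 <= t < 1 -> t = 0 \/ G u v ->
  to_vertex (edge_point u v t) w <= t + (vdist G u w)%:R.
Proof.
move=> t01 Guv; case: edge_pointP => //= [->|H|H]; first by rewrite add0r.
  by rewrite ge_min lexx.
by rewrite ge_min opprB addrCA subrr addr0 lexx orbT.
Qed.

Lemma to_vertex_edge_point_r u v t w : 0 <= t < 1 -> G u v ->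
  to_vertex (edge_point u v t) w <= 1 - t + (vdist G v w)%:R.
Proof.
move=> t01 Guv; case: edge_pointP => //= [|->|H|H]; first by right.
- by have := vdist_trR u v w; rewrite subr0 (vdist_edge Gconn Guv).
- by rewrite ge_min lexx orbT.
- by rewrite ge_min lexx.
Qed.

Lemma dist_edge_point x u v t : 0 <= t < 1 -> t = 0 \/ G u v ->
  dist x (edge_point u v t) <= to_vertex x u + t.
Proof.
move=> t01 Guv; case: edge_pointP => //= [->|H|H]; first by rewrite addr0.
- by apply: le_trans (dist_le_outside x H) _; rewrite ge_min lexx.
- apply: le_trans (dist_le_outside x H) _.
  by rewrite ge_min opprB [1 + (t - 1)]addrC subrK lexx orbT.
Qed.

Lemma dist_edge_point_r x u v t : 0 <= t < 1 -> G u v ->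
  dist x (edge_point u v t) <= to_vertex x v + (1 - t).
Proof.
move=> t01 Guv; case: edge_pointP => //= [|->|H|H]; first by right.
- by have := to_vertex_vdist x v u; rewrite subr0 (vdist_edge Gconn (v := u)) ?(edge_sym G v).
- by apply: le_trans (dist_le_outside x H) _; rewrite ge_min lexx orbT.
- by apply: le_trans (dist_le_outside x H) _; rewrite ge_min lexx.
Qed.

Lemma dist_edge_point_same u v s t : 0 <= s < 1 -> 0 <= t < 1 ->
    s = 0 \/ G u v -> t = 0 \/ G u v ->
  dist (edge_point u v s) (edge_point u v t) <= `|s - t|.
Proof.
move=> s01 t01 Gs Gt.
have [s0|s_neq0] := eqVneq s 0.
  apply: le_trans (dist_edge_point _ t01 Gt) _.
  rewrite s0 sub0r normrN ger0_norm; last by case/andP: t01.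
  by rewrite /edge_point eqxx /= vdistxx add0r.
have [t0|t_neq0] := eqVneq t 0.
  rewrite t0 subr0 ger0_norm; last by case/andP: s01.
  rewrite /edge_point eqxx -/(edge_point u v s) /=.
  by apply: le_trans (to_vertex_edge_point _ s01 Gs) _; rewrite vdistxx addr0.
case: edge_pointP => // [s0|H|H]; first by rewrite s0 eqxx in s_neq0.
  case: edge_pointP => // [t0|H'|H']; first by rewrite t0 eqxx in t_neq0.
    by rewrite /= !eqxx.
  (* Both points are named along the same direction of the edge, so it cannot be that exactly one of
     them is flipped. *)
  by case/andP: (H) => lt_uv _; case/andP: (H'); rewrite ltnNge ltnW.
case: edge_pointP => // [t0|H'|H']; first by rewrite t0 eqxx in t_neq0.
  by case/andP: (H) => lt_uv _; case/andP: (H'); rewrite ltnNge ltnW.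
rewrite /= !eqxx distrC; have -> : 1 - t - (1 - s) = s - t by ring.
by [].
Qed.

End Points.

(** * Shortest paths between vertices, as curves in A(G) *)

Section Geodesics.
Context (R : realType) (n : nat) (G : sgraph n).
Hypothesis Gconn : connected G.
Implicit Types (x y : 'I_n) (s t : R) (g : R -> gpoint R G).

(** At [t = size p] the index [k.+1] falls outside the list and [nth] returns the default [x]; this
    is harmless, since the position on the edge is then 0. *)
Definition walk_point (x : 'I_n) (p : seq 'I_n) (t : R) : gpoint R G :=
  let k := Num.truncn t in
  edge_point G (nth x (x :: p) k) (nth x (x :: p) k.+1) (t - k%:R).

Lemma walk_point_nat x p k : walk_point x p k%:R = Vertex (nth x (x :: p) k).
Proof. by rewrite /walk_point natrK subrr /edge_point eqxx. Qed.

(** Moving along the walk bounds every distance from above by [|s - t|]. A smaller distance would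
    give a shortcut from [x] to [y], against the minimal length of [p]. *)
Lemma walk_point_shortest x y p :
    path G x p -> last x p = y -> size p = vdist G x y ->
  shortest_path (Vertex x) (Vertex y) (walk_point x p).
Proof.
move=> pth lastp sizep.
pose P k := nth x (x :: p) k.
have P_adj k : (k < size p)%N -> G (P k) (P k.+1) by move/(pathP x pth).
have P0 : P 0%N = x by [].
have PD : P (size p) = y by rewrite /P (nth_last x (x :: p)) /= -lastp.
have P_dist i j : (i <= j <= size p)%N -> (vdist G (P i) (P j) <= j - i)%N.
  elim: j => [|j IHj] /andP[le_ij lt_jD].
    by move: le_ij; rewrite leqn0 => /eqP->; rewrite vdistxx.
  move: le_ij; rewrite leq_eqVlt => /orP[/eqP <-|le_ij].
    by rewrite vdistxx.
  have := vdist_edge_r Gconn (P i) (P_adj _ lt_jD).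
  by have := IHj (introT andP (conj le_ij (ltnW lt_jD))); lia.
have P_distR i j : (i <= j <= size p)%N -> (vdist G (P i) (P j))%:R <= j%:R - i%:R :> R.
  by move=> ij; rewrite -natrB; [rewrite ler_nat P_dist | case/andP: ij].
have truncP t : 0 <= t <= (size p)%:R ->
    [/\ 0 <= t - (Num.truncn t)%:R < 1, (Num.truncn t <= size p)%N &
        t - (Num.truncn t)%:R = 0 \/ (Num.truncn t < size p)%N].
  move=> /andP[t_ge0 t_leD]; have /andP[kt tk] := truncn_itv t_ge0.
  have kD : (Num.truncn t <= size p)%N by rewrite -(ler_nat R) (le_trans kt).
  split=> //; first by rewrite -natr1 in tk; apply/andP; split; lra.
  move: kD; rewrite leq_eqVlt => /orP[/eqP kD|]; last by right.
  by left; rewrite kD in kt *; lra.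
have frac_adj t : 0 <= t <= (size p)%:R ->
    t - (Num.truncn t)%:R = 0 \/ G (P (Num.truncn t)) (P (Num.truncn t).+1).
  by case/truncP=> _ _ [|/P_adj]; [left|right].
have to_P t j : 0 <= t <= (size p)%:R -> (j <= size p)%N ->
    to_vertex (walk_point x p t) (P j) <= `|t - j%:R|.
  move=> t0D jD; have [f01 kD kD'] := truncP t t0D.
  have [le_jk|lt_kj] := leqP j (Num.truncn t).
    apply: le_trans (to_vertex_edge_point _ f01 (frac_adj _ t0D)) _.
    have := P_distR j (Num.truncn t); rewrite le_jk kD -/(P _) vdistC // => /(_ isT).
    by have := ler_norm (t - j%:R); lra.
  have lt_kD := leq_trans lt_kj jD.
  apply: le_trans (to_vertex_edge_point_r Gconn _ f01 (P_adj _ lt_kD)) _.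
  have := P_distR (Num.truncn t).+1 j; rewrite lt_kj jD -/(P _) -natr1 => /(_ isT).
  by have := ler_norm (j%:R - t); rewrite distrC; lra.
have to_x t : 0 <= t <= (size p)%:R -> to_vertex (walk_point x p t) x <= t.
  move=> t0D; have := to_P t 0%N t0D isT; rewrite subr0 P0 ger0_norm //.
  by case/andP: t0D.
have to_y t : 0 <= t <= (size p)%:R -> to_vertex (walk_point x p t) y <= (size p)%:R - t.
  move=> t0D; have := to_P t _ t0D (leqnn _); rewrite PD distrC ger0_norm //.
  by case/andP: t0D; lra.
have dist_le s t : 0 <= s <= (size p)%:R -> 0 <= t <= (size p)%:R ->
    dist (walk_point x p s) (walk_point x p t) <= `|s - t|.
  move=> s0D t0D; have [fs01 kD kD'] := truncP s s0D.
  have [ft01 lD lD'] := truncP t t0D.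
  (* On different edges of the walk, the second point is reached through the end of its edge that
     faces the first. *)
  have [lt_kl|lt_lk|eq_kl] := ltngtP (Num.truncn s) (Num.truncn t).
  - apply: le_trans (dist_edge_point Gconn _ ft01 (frac_adj _ t0D)) _.
    have := to_P s _ s0D lD; rewrite -/(P _).
    have : (Num.truncn s).+1%:R <= (Num.truncn t)%:R :> R by rewrite ler_nat.
    rewrite -natr1 => kl; rewrite [`|s - _%:R|]distrC ger0_norm; last lra.
    by have := ler_norm (t - s); rewrite distrC; lra.
  - have lt_lD := leq_trans lt_lk kD.
    apply: le_trans (dist_edge_point_r Gconn _ ft01 (P_adj _ lt_lD)) _.
    have := to_P s _ s0D lt_lD; rewrite -/(P _).
    have : (Num.truncn t).+1%:R <= (Num.truncn s)%:R :> R by rewrite ler_nat.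
    rewrite -natr1 => kl; rewrite ger0_norm; last lra.
    by have := ler_norm (s - t); lra.
  - have := frac_adj _ s0D; rewrite eq_kl => Gs.
    rewrite /walk_point eq_kl; rewrite eq_kl in fs01.
    apply: le_trans (dist_edge_point_same Gconn fs01 ft01 Gs (frac_adj _ t0D)) _.
    by rewrite opprD addrACA subrr addr0.
have lower s t : 0 <= s <= (size p)%:R -> 0 <= t <= (size p)%:R ->
    `|s - t| <= dist (walk_point x p s) (walk_point x p t).
  move=> s0D t0D; rewrite ler_norml; apply/andP; split.
    (* The way from [x] to [y] through both points gives one sign; the way from [y] to [x] gives the
       other. *)
    have := to_vertex_triangle Gconn (Vertex x) (walk_point x p s) y.
    rewrite dist_Vertex //= -sizep.
    have := to_vertex_triangle Gconn (walk_point x p s) (walk_point x p t) y.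
    by have := to_x s s0D; have := to_y t t0D; lra.
  have := to_vertex_triangle Gconn (Vertex y) (walk_point x p s) x.
  rewrite dist_Vertex //= vdistC // -sizep.
  have := to_vertex_triangle Gconn (walk_point x p s) (walk_point x p t) x.
  by have := to_y s s0D; have := to_x t t0D; lra.
split; first exact: walk_point_nat 0%N.
  by rewrite /= -sizep walk_point_nat -/(P _) PD.
by move=> s t; rewrite /= -sizep => s0D t0D; apply/eqP; rewrite eq_le dist_le ?lower.
Qed.

Lemma shortest_path_exists x y : exists g : R -> gpoint R G,
  shortest_path (Vertex x) (Vertex y) g.
Proof.
have [p [pth lp sp]] := vdist_path Gconn x y.
by exists (walk_point x p); apply: walk_point_shortest.
Qed.

Lemma shortest_path_rev x y g : shortest_path (Vertex x) (Vertex y) g ->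
  shortest_path (Vertex y) (Vertex x)
    (fun t => g (dist (Vertex x : gpoint R G) (Vertex y) - t)).
Proof.
rewrite /shortest_path /= => -[g0 gD gg].
rewrite (vdistC Gconn y x) subr0 subrr; split=> // s t s0D t0D.
rewrite gg; [|by case/andP: s0D => *; apply/andP; split; lra
            |by case/andP: t0D => *; apply/andP; split; lra].
by rewrite opprD addrACA subrr add0r opprK addrC distrC.
Qed.

Lemma to_vertex_shortest_path x y g t :
    shortest_path (Vertex x) (Vertex y) g -> 0 <= t <= (vdist G x y)%:R ->
  to_vertex (g t) y = (vdist G x y)%:R - t.
Proof.
rewrite /shortest_path /= => -[_ gD gg] t0D.
have D0 : 0 <= ((vdist G x y)%:R : R) <= (vdist G x y)%:R by apply/andP; split.
have := gg t _ t0D D0; rewrite gD /= => ->; rewrite distrC ger0_norm //.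
by case/andP: t0D; lra.
Qed.

End Geodesics.

(** * Insize *)

Section Hyperbolicity.
Context (R : realType) (n : nat) (G : sgraph n) (delta : R).
Hypothesis Gconn : connected G.
Hypothesis thin : insizes_at_most G delta.
Implicit Types (u v w x y z a b : 'I_n) (c : gpoint R G) (t : R).

(** This crude bound and the next one make the set in [corner_size] bounded above, so that its
    supremum is a genuine upper bound. *)
Lemma to_vertex_bound c w : to_vertex c w <= n%:R + 1.
Proof.
case: c => [u|u v t /and4P[_ _ t_gt0 t_lt1]] /=.
  by have : (vdist G u w)%:R <= n%:R :> R; [rewrite ler_nat vdist_leq_order | lra].
rewrite ge_min; apply/orP; left.
by have : (vdist G u w)%:R <= n%:R :> R; [rewrite ler_nat vdist_leq_order | lra].
Qed.

Lemma dist_bound c (c' : gpoint R G) : dist c c' <= n%:R + 2.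
Proof.
case: c' => [w|u v t H]; first by have := to_vertex_bound c w; rewrite /=; lra.
apply: le_trans (dist_le_outside Gconn c H) _; rewrite ge_min; apply/orP; left.
by have := to_vertex_bound c u; case/and4P: H => _ _ t_gt0 t_lt1; lra.
Qed.

(** The right-hand side of the last hypothesis is twice [alpha_x]. The other corners are instances
    of this one after renaming, and any shortest path serves as the third side. *)
Lemma corner_le x y z gxy gxz t :
    shortest_path (Vertex x : gpoint R G) (Vertex y) gxy ->
    shortest_path (Vertex x : gpoint R G) (Vertex z) gxz ->
    0 <= t ->
    2 * t <= (vdist G x y)%:R + (vdist G x z)%:R - (vdist G y z)%:R ->
  dist (gxy t) (gxz t) <= delta.
Proof.
move=> xy xz t_ge0 le_t; have [gyz yz] := shortest_path_exists R Gconn y z.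
have := thin xy yz xz; rewrite /insize ge_max => /andP[+ _]; apply: le_trans.
apply: ub_le_sup.
  by exists (n%:R + 2) => _ [s _ <-]; apply: dist_bound.
by exists t => //=; rewrite /half_perimeter /=; apply/andP; split; lra.
Qed.

(** In the degenerate triangle with three equal corners, the bound applies to the distance 0 of a
    point to itself. *)
Lemma insizes_ge0 : 0 <= delta.
Proof.
pose x := Ordinal Gconn.1; have [g gx] := shortest_path_exists R Gconn x x.
have := corner_le gx gx (lexx 0); rewrite vdistxx // mulr0 subr0 addr0 => /(_ (lexx 0)).
by case: gx => -> _ _ /=; rewrite vdistxx.
Qed.

(** With [t = d(v,b)/2], go from [b] to [a] through the points at distance [t] from [v] on [[v,b]],
    [[v,u]] and [[v,a]]: the length is at most [t + delta + delta + (d(v,a) - t)]. *)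
Lemma vdist_le_far u v a b : (forall w, vdist G u w <= vdist G u v)%N ->
    (vdist G v b <= vdist G v a)%N ->
  (vdist G a b)%:R <= (vdist G v a)%:R + 2 * delta.
Proof.
move=> far_v le_ba.
have [gu vu] := shortest_path_exists R Gconn v u.
have [ga va] := shortest_path_exists R Gconn v a.
have [gb vb] := shortest_path_exists R Gconn v b.
pose t : R := (vdist G v b)%:R / 2.
have t_ge0 : 0 <= t by rewrite divr_ge0.
have fa : (vdist G u a)%:R <= (vdist G v u)%:R :> R by rewrite ler_nat (vdistC Gconn v).
have fb : (vdist G b u)%:R <= (vdist G v u)%:R :> R.
  by rewrite ler_nat !(vdistC Gconn _ u) in far_v *.
have leR : (vdist G v b)%:R <= (vdist G v a)%:R :> R by rewrite ler_nat.
(* As [d(u,a)] and [d(b,u)] are at most [d(v,u)], the corner at [v] reaches at least to [t] in both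
   triangles. *)
have ua : dist (gu t) (ga t) <= delta by apply: corner_le vu va _ _; rewrite // /t; lra.
have bu : dist (gb t) (gu t) <= delta by apply: corner_le vb vu _ _; rewrite // /t; lra.
have := to_vertex_triangle Gconn (Vertex b) (gb t) a.
have := to_vertex_triangle Gconn (gb t) (gu t) a.
have := to_vertex_triangle Gconn (gu t) (ga t) a.
rewrite dist_Vertex // (to_vertex_shortest_path va) ?(to_vertex_shortest_path vb) /=.
- by rewrite (vdistC Gconn b) /t; lra.
- by rewrite t_ge0 /=; rewrite /t in t_ge0 *; lra.
- by rewrite t_ge0 /=; rewrite /t in t_ge0 *; lra.
Qed.

Lemma ecc_ge c v : dist (Vertex v) c <= ecc c.
Proof. by rewrite /ecc (bigD1 v) //= le_max lexx. Qed.

(** For every centre [c], one of [x] and [y] is at distance at least [d(x,y)/2] from it. *)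
Lemma radius1_ge x y : (vdist G x y)%:R <= 2 * radius1 R G.
Proof.
suff : (vdist G x y)%:R / 2 <= radius1 R G by lra.
apply: lb_le_inf; first by exists (ecc (Vertex x : gpoint R G)); exists (Vertex x).
move=> _ [c _ <-]; have := to_vertex_triangle Gconn (Vertex x) c y.
by have := ecc_ge c x; have := ecc_ge c y; rewrite !dist_Vertex //=; lra.
Qed.

Lemma midpoint_dominates x y g :
    (forall v, vdist G x v <= vdist G x y)%N ->
    (forall v, vdist G y v <= vdist G x y)%N ->
    shortest_path (Vertex x : gpoint R G) (Vertex y) g ->
  dominates (radius1 R G + delta) (g ((vdist G x y)%:R / 2)).
Proof.
move=> far_x far_y.
(* Reversing the side exchanges its ends, so it suffices to treat vertices that are at least as far
   from the start as from the end. *)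
suff half x' y' g' v : (forall w, vdist G x' w <= vdist G x' y')%N ->
    (vdist G y' v <= vdist G x' v)%N -> shortest_path (Vertex x' : gpoint R G) (Vertex y') g' ->
    dist (Vertex v) (g' ((vdist G x' y')%:R / 2)) <= radius1 R G + delta.
  move=> xy v; have [le_yx|/ltnW le_xy] := leqP (vdist G y v) (vdist G x v).
    exact: half far_x le_yx xy.
  have far_y' w : (vdist G y w <= vdist G y x)%N by rewrite (vdistC Gconn _ x).
  have := half _ _ _ _ far_y' le_xy (shortest_path_rev Gconn xy).
  rewrite (vdistC Gconn y x) /=; congr (dist _ (g _) <= _); lra.
move=> far le_v xy; set t := _ / 2.
have [gv xv] := shortest_path_exists R Gconn x' v.
have leR : (vdist G y' v)%:R <= (vdist G x' v)%:R :> R by rewrite ler_nat.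
have farR : (vdist G x' v)%:R <= (vdist G x' y')%:R :> R by rewrite ler_nat.
have t_ge0 : 0 <= t by rewrite divr_ge0.
have yv : dist (g' t) (gv t) <= delta by apply: corner_le xy xv _ _; rewrite // /t; lra.
(* This yields [t <= d(x',v)], so that [gv t] does lie on the side from [x'] to [v]. *)
have triR : (vdist G x' y')%:R <= (vdist G x' v)%:R + (vdist G y' v)%:R :> R.
  by rewrite -natrD ler_nat (vdistC Gconn y') vdist_triangle.
rewrite dist_Vertex //; have := to_vertex_triangle Gconn (g' t) (gv t) v.
rewrite (to_vertex_shortest_path xv); last by rewrite t_ge0 /=; rewrite /t in t_ge0 *; lra.
by have := radius1_ge x' y'; rewrite /t in yv *; lra.
Qed.

End Hyperbolicity.

(** * Time credits *)

Local Open Scope nat_scope.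

(* The first argument of [Q] is the number of unused time credits. *)
Definition wp (P : com) (s : store) (k : nat) (Q : nat -> store -> Prop) : Prop :=
  exists t s', [/\ exec P s t s', t <= k & Q (k - t) s'].

Lemma wp_skip s k (Q : nat -> store -> Prop) : 0 < k -> Q (k - 1) s -> wp Skip s k Q.
Proof. by move=> k_gt0 Qs; exists 1, s; split=> //; apply: exec_skip. Qed.

Lemma wp_put a i e s k (Q : nat -> store -> Prop) : (cost i + cost e).+1 <= k ->
    Q (k - (cost i + cost e).+1) (update s a (eval s i) (eval s e)) ->
  wp (Put a i e) s k Q.
Proof. by move=> le_k Qs; do 2!eexists; split; [apply: exec_put| |apply: Qs]. Qed.

Lemma wp_seq P1 P2 s k Q :
  wp P1 s k (fun k' s' => wp P2 s' k' Q) -> wp (Seq P1 P2) s k Q.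
Proof.
move=> [t1 [s1 [ex1 le1 [t2 [s2 [ex2 le2 Qs]]]]]].
exists (t1 + t2), s2; split; [exact: exec_seq ex1 ex2 | lia | by rewrite subnDA].
Qed.

Lemma wp_if e P1 P2 s k Q : cost e < k ->
    wp (if eval s e != 0 then P1 else P2) s (k - (cost e).+1) Q ->
  wp (If e P1 P2) s k Q.
Proof.
move=> lt_k [t [s' [ex le_t Qs]]]; exists (cost e + t).+1, s'; split; [|lia|].
  by case: eqVneq ex; [apply: exec_if_false | apply: exec_if_true].
by move: Qs; rewrite -subnDA addSn.
Qed.

(** Each test consumes credits, so induction on the credits proves termination without a separate
    variant. *)
Lemma wp_while (Inv : nat -> store -> Prop) e P (Q : nat -> store -> Prop) :
    (forall k s, Inv k s -> cost e < k /\
       if eval s e != 0 then wp P s (k - (cost e).+1) Inv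
       else Q (k - (cost e).+1) s) ->
  forall k s, Inv k s -> wp (While e P) s k Q.
Proof.
move=> step; elim/ltn_ind=> k IHk s /step[lt_k]; case: eqVneq => [e0|e_neq0] /=.
  by move=> Qs; exists (cost e).+1, s; split=> //; apply: exec_while_false.
move=> [t1 [s1 [ex1 le1 /IHk]]] [|t2 [s2 [ex2 le2 Qs]]]; first lia.
exists (cost e + t1 + t2).+1, s2; split; [exact: exec_while_true ex1 ex2 | lia |].
by congr Q: Qs; lia.
Qed.

(** * The layout of the adjacency lists in memory *)

Section AdjacencyLists.
Context (n : nat) (adj : 'I_n -> seq 'I_n).

Lemma input_offset (u : 'I_n) : input adj 1 u.+1 = input adj 1 u + size (adj u).
Proof.
rewrite /= ltn_ord (ltnW (ltn_ord u)) [LHS](bigD1 u) //= addnC; congr addn.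
by apply: eq_bigl => v; rewrite ltnS andbC -val_eqE /= -ltn_neqAle.
Qed.

(** The offsets are the partial sums of the shape of the list of lists, so the cell read is a
    [flatten_index]. *)
Lemma input_entry (u : 'I_n) i : i < size (adj u) ->
  input adj 2 (input adj 1 u + i) = nth u (adj u) i.
Proof.
move=> lt_i; set ss := [seq map val (adj v) | v <- enum 'I_n].
have ss_u : nth [::] ss u = map val (adj u).
  by rewrite (nth_map u) ?size_enum_ord // nth_ord_enum.
have size_ss : size ss = n by rewrite /ss size_map size_enum_ord.
have off m : m <= n -> input adj 1 m = sumn (take m (shape ss)).
  elim: m => [|m IHm] lt_mn; first by rewrite take0 /= big_pred0.
  rewrite (input_offset (Ordinal lt_mn)) IHm 1?ltnW //=.
  have lt_m : m < size (shape ss) by rewrite size_map size_ss.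
  rewrite (take_nth 0 lt_m) sumn_rcons; congr addn.
  rewrite (nth_map [::]) ?size_ss //.
  rewrite (nth_map (Ordinal lt_mn)) ?size_enum_ord // size_map.
  by rewrite (nth_ord_enum _ (Ordinal lt_mn)).
have lt_i' : i < nth 0 (shape ss) u.
  by rewrite (nth_map [::]) ?size_ss // ss_u size_map.
rewrite off 1?ltnW // -/(flatten_index (shape ss) u i) [LHS]nth_flatten.
by rewrite flatten_indexKl // flatten_indexKr // ss_u (nth_map u).
Qed.

End AdjacencyLists.

(** * Breadth-first search *)

Definition upd (f : nat -> nat) (i k : nat) : nat -> nat :=
  fun j => if j == i then k else f j.

Lemma mkseq_upd f h t k : h <= t -> mkseq (upd f t k) h = mkseq f h.
Proof.
move=> le_ht; apply/eq_in_map => i; rewrite mem_iota add0n /upd => /andP[_ lt_ih].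
by case: eqP => // it; lia.
Qed.

Section BreadthFirstSearch.
Context (n : nat) (G : sgraph n).
Hypothesis Gconn : connected G.
Implicit Types (src u v w : 'I_n) (D P Q : nat -> nat).

(* D holds distances plus one, 0 marking unvisited vertices, and P parents; the
   queue Q consists of its first t cells, the vertices in cells below h having
   been processed. *)
Record bfs_inv src D P Q (h t : nat) : Prop := BfsInv {
  bfs_head : h <= t;
  bfs_pos : 0 < t;
  bfs_queue : forall i, i < t -> exists2 u : 'I_n, Q i = u & D u != 0;
  bfs_visited : forall u, D u != 0 -> exists2 i, i < t & Q i = u;
  bfs_uniq : uniq (mkseq Q t);
  bfs_mono : forall i j, i <= j -> j < t -> D (Q i) <= D (Q j);
  bfs_window : forall j, h < t -> j < t -> D (Q j) <= D (Q h) + 1;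
  bfs_done : forall i u w, i < h -> Q i = u -> G u w ->
    D w != 0 /\ D w <= D u + 1;
  bfs_parent : forall w, D w != 0 -> w != src ->
    exists p : 'I_n, [/\ P w = p, G p w, D p != 0 & D w = D p + 1];
  bfs_source : D src = 1 }.

Lemma bfs_inv_start src D P Q :
    (forall w, D w = (w == src)) -> Q 0 = src -> bfs_inv src D P Q 0 1.
Proof.
move=> D_src Q0; split=> //.
- by case=> // _; exists src; rewrite ?D_src ?eqxx.
- by move=> u; rewrite D_src eqb0 negbK => /eqP->; exists 0.
- by move=> [|i] [|j].
- by case=> // _ _; rewrite leq_addr.
- by move=> w; rewrite D_src eqb0 negbK => /eqP->; rewrite eqxx.
- by rewrite D_src eqxx.
Qed.

(** By [bfs_window] no queued vertex has a value above [D u + 1], so appending [w] keeps the queue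
    sorted. *)
Lemma bfs_inv_visit src D P Q h t u w :
    bfs_inv src D P Q h t -> h < t -> Q h = u -> G u w -> D w = 0 ->
  bfs_inv src (upd D w (D u + 1)) (upd P w u) (upd Q t w) h t.+1.
Proof.
case=> le_ht t_gt0 queue visited uniqQ mono window dn parent source.
move=> lt_ht Qh Guw Dw0.
have Dne v : D v != 0 -> (v == w :> nat) = false.
  by case: (eqVneq (v : nat) w) => // ->; rewrite Dw0.
have Qt i : i < t -> (i == t) = false by move=> ?; lia.
have DQ i : i < t -> upd D w (D u + 1) (upd Q t w i) = D (Q i).
  by move=> lt_i; rewrite /upd Qt //; have [v -> /Dne->] := queue i lt_i.
have DQt : upd D w (D u + 1) (upd Q t w t) = D u + 1 by rewrite /upd !eqxx.
have Dmono v : D v != 0 -> upd D w (D u + 1) v = D v by move=> /Dne; rewrite /upd => ->.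
have Du : D u != 0 by have [v] := queue h lt_ht; rewrite Qh => <-.
split.
- exact: leqW.
- by [].
- move=> i; rewrite ltnS leq_eqVlt => /orP[/eqP->|lt_i].
    by exists w; rewrite /upd eqxx // addn1.
  have [v Qi Dv] := queue i lt_i; exists v; first by rewrite /upd Qt.
  by rewrite Dmono.
- move=> v; rewrite {1}/upd; case: (eqVneq (v : nat) w) => [/val_inj -> _|_ /visited[i lt_i Qi]].
    by exists t; rewrite // /upd eqxx.
  by exists i; rewrite ?(leqW lt_i) // /upd Qt.
- rewrite mkseqS rcons_uniq mkseq_upd // /upd eqxx uniqQ andbT.
  apply/mapP => -[i]; rewrite mem_iota add0n => /andP[_ lt_i] Qi.
  by have [v] := queue i lt_i; rewrite -Qi => <-; rewrite Dw0.
- move=> i j le_ij; rewrite ltnS leq_eqVlt => /orP[/eqP ej|lt_j].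
    subst j; move: le_ij; rewrite leq_eqVlt => /orP[/eqP->//|lt_i].
    by rewrite DQt DQ // -Qh window.
  by rewrite !DQ ?mono //; lia.
- move=> j _; rewrite ltnS (DQ h) // leq_eqVlt => /orP[/eqP->|lt_j].
    by rewrite DQt Qh.
  by rewrite DQ // window.
- move=> i x y lt_i; rewrite {1}/upd Qt; last lia.
  move=> Qi Gxy; have [Dy0 Dy] := dn i x y lt_i Qi Gxy.
  have [x' Qi' Dx0] := queue i (ltn_trans lt_i lt_ht).
  by rewrite !Dmono //; move: Dx0; rewrite -Qi' Qi.
- move=> v Dv vsrc; have [vw|vw] := eqVneq v w.
    by exists u; rewrite vw Dmono // /upd !eqxx.
  have vw' : (v == w :> nat) = false by apply: negbTE.
  have Dv' : D v != 0 by move: Dv; rewrite /upd vw'.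
  have [p [Pv Gpv Dp Dvp]] := parent v Dv' vsrc.
  by exists p; rewrite !Dmono // /upd vw'.
- by rewrite Dmono ?source.
Qed.

(** The window survives because, by monotonicity, the new head has at least the value of the old
    one. *)
Lemma bfs_inv_next src D P Q h t u :
    bfs_inv src D P Q h t -> h < t -> Q h = u ->
    (forall w, G u w -> D w != 0 /\ D w <= D u + 1) ->
  bfs_inv src D P Q h.+1 t.
Proof.
case=> le_ht t_gt0 queue visited uniqQ mono window dn parent source.
move=> lt_ht Qh nbr; split=> //.
- move=> j lt_h1t lt_jt; apply: leq_trans (window j lt_ht lt_jt) _.
  by rewrite leq_add2r mono.
- move=> i v w; rewrite ltnS leq_eqVlt => /orP[/eqP->|]; last exact: dn.
  by rewrite Qh => /val_inj <-; apply: nbr.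
Qed.

Definition bfs_result src D P (far : nat) : Prop :=
  [/\ forall w, D w = vdist G src w + 1,
      forall w, w != src ->
        exists p : 'I_n, [/\ P w = p, G p w & vdist G src w = vdist G src p + 1] &
      exists2 v : 'I_n, far = v & forall w, vdist G src w <= vdist G src v].

(** Once the queue is exhausted, [D] grows by at most 1 along every edge, so every vertex is visited
    and [D] is at most the distance plus 1. Following parents gives the reverse bound. By
    monotonicity the last queued vertex is a farthest one. *)
Lemma bfs_inv_result src D P Q t :
  bfs_inv src D P Q t t -> bfs_result src D P (Q t.-1).
Proof.
case=> le_ht t_gt0 queue visited uniqQ mono window dn parent source.
have stepD u w : D u != 0 -> G u w -> D w != 0 /\ D w <= D u + 1.
  by move=> /visited[i lt_i Qi]; apply: dn Qi.
have pathD p u : D u != 0 -> path G u p ->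
    D (last u p) != 0 /\ D (last u p) <= D u + size p.
  elim: p u => [|w p IHp] u Du /=; first by rewrite addn0.
  case/andP=> /(stepD _ _ Du)[Dw le_w] /(IHp _ Dw)[Dl le_l]; split=> //; lia.
have src_neq0 : D src != 0 by rewrite source.
have D_le w : D w != 0 /\ D w <= vdist G src w + 1.
  have [p [pth lp <-]] := vdist_path Gconn src w.
  by have := pathD p src src_neq0 pth; rewrite lp source addnC.
have D_ge k w : D w <= k -> vdist G src w + 1 <= D w.
  elim: k w => [|k IHk] w; first by rewrite leqn0 => /eqP Dw; case: (D_le w); rewrite Dw.
  have [->|w_src] := eqVneq w src; first by rewrite vdistxx source.
  have [p [_ Gpw Dp Dw]] := parent w (D_le w).1 w_src.
  by have := vdist_edge_r Gconn src Gpw; have := IHk p; lia.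
have D_eq w : D w = vdist G src w + 1.
  by apply/eqP; rewrite eqn_leq (D_le w).2 (D_ge (D w)).
split=> //.
  move=> w w_src; have [p [Pw Gpw Dp Dw]] := parent w (D_le w).1 w_src.
  by exists p; split=> //; rewrite !D_eq in Dw; lia.
have lt_t : t.-1 < t by lia.
have [v Qv Dv] := queue _ lt_t; exists v => // w.
have [i lt_i Qi] := visited w (D_le w).1.
by have := mono i t.-1; rewrite Qi Qv !D_eq => /(_ _ lt_t); lia.
Qed.

(** The potential of the search: every vertex not yet processed still has to be paid for, by its
    degree plus 1. *)
Definition work (adj : 'I_n -> seq 'I_n) Q h : nat :=
  \sum_(u < n | val u \notin mkseq Q h) (size (adj u) + 1).

Lemma work0 adj Q : work adj Q 0 = \sum_(u < n) (size (adj u) + 1).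
Proof. by []. Qed.

Lemma workS adj Q h u : uniq (mkseq Q h.+1) -> Q h = u ->
  work adj Q h = size (adj u) + 1 + work adj Q h.+1.
Proof.
rewrite mkseqS rcons_uniq => /andP[u_notin _] Qh.
rewrite /work (bigD1 u) /=; last by rewrite -Qh.
congr addn; apply: eq_bigl => v.
by rewrite mkseqS mem_rcons inE negb_or Qh andbC val_eqE.
Qed.

Lemma work_upd adj Q h t k : h <= t -> work adj (upd Q t k) h = work adj Q h.
Proof.
by move=> le_ht; rewrite /work mkseq_upd.
Qed.

Lemma uniq_mkseq_le Q h t : h <= t -> uniq (mkseq Q t) -> uniq (mkseq Q h).
Proof.
move=> /subnKC <-; rewrite /mkseq iotaD map_cat cat_uniq.
by case/and3P.
Qed.

End BreadthFirstSearch.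

(** * The program for breadth-first search *)

Local Notation var a := (Get a (Const 0)).
Local Notation set_var a e := (Put a (Const 0) e).
(** Names in [v] stand for arrays of which only cell 0 is used, as scalar variables. *)
Local Notation aout := 3.
Local Notation adist := 4.
Local Notation aparent := 5.
Local Notation aqueue := 6.
Local Notation vsrc := 7.
Local Notation vfar := 8.
Local Notation vold := 9.
Local Notation vhead := 10.
Local Notation vtail := 11.
Local Notation vedge := 12.
Local Notation vcur := 13.
Local Notation vnbr := 14.

(** As a test, a truncated difference [Sub a b] means [b < a]. Only distances are reset, since 0
    marks unvisited vertices; stale parents and queue cells are overwritten before being read. *)
Definition clear_prog : com :=
  Seq (set_var vhead (Const 0))
      (While (Defs.Sub (var 0) (var vhead))
         (Seq (Put adist (var vhead) (Const 0))
              (set_var vhead (Add (var vhead) (Const 1))))).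

Definition scan_prog : com :=
  While (Defs.Sub (Get 1 (Add (var vcur) (Const 1))) (var vedge))
    (Seq (set_var vnbr (Get 2 (var vedge)))
    (Seq (set_var vedge (Add (var vedge) (Const 1)))
         (If (Get adist (var vnbr)) Skip
            (Seq (Put adist (var vnbr) (Add (Get adist (var vcur)) (Const 1)))
            (Seq (Put aparent (var vnbr) (var vcur))
            (Seq (Put aqueue (var vtail) (var vnbr))
                 (set_var vtail (Add (var vtail) (Const 1))))))))).

Definition bfs_prog : com :=
  Seq clear_prog
  (Seq (Put adist (var vsrc) (Const 1))
  (Seq (Put aqueue (Const 0) (var vsrc))
  (Seq (set_var vhead (Const 0))
  (Seq (set_var vtail (Const 1))
  (Seq (While (Defs.Sub (var vtail) (var vhead))
          (Seq (set_var vcur (Get aqueue (var vhead)))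
          (Seq (set_var vedge (Get 1 (var vcur)))
          (Seq scan_prog
               (set_var vhead (Add (var vhead) (Const 1)))))))
       (set_var vfar (Get aqueue (Defs.Sub (var vtail) (Const 1))))))))).

Ltac wp_assign := apply: wp_put; [rewrite /=; lia | rewrite /update /=].

(** * Correctness and cost of the search program *)

Section Search.
Context (n : nat) (G : sgraph n) (adj : 'I_n -> seq 'I_n) (offset entry : nat -> nat).
Hypothesis Gconn : connected G.
Hypothesis adjG : adjacency_lists G adj.
Hypothesis offsetS : forall u : 'I_n, offset u.+1 = offset u + size (adj u).
Hypothesis entryE : forall (u : 'I_n) i,
  i < size (adj u) -> entry (offset u + i) = nth u (adj u) i.
Implicit Types (src old u v w : 'I_n) (s : store) (k r : nat).

Record holds_input s src old : Prop := HoldsInput {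
  input_order : s 0 0 = n;
  input_offsets : s 1 = offset;
  input_entries : s 2 = entry;
  input_source : s vsrc 0 = src;
  input_old : s vold 0 = old }.

(** Here and below, [r] counts the credits handed on to the continuation [Q], and the numerical
    coefficients are generous. *)
Lemma wp_clear src old s k r (Q : nat -> store -> Prop) :
    holds_input s src old -> 20 * n + 10 + r <= k ->
    (forall k' s', r <= k' -> holds_input s' src old ->
      (forall u, s' adist u = 0) -> Q k' s') ->
  wp clear_prog s k Q.
Proof.
case=> s0 s1 s2 ssrc sold le_k post; apply: wp_seq; wp_assign.
pose Inv k' s' := [/\ holds_input s' src old, s' vhead 0 <= n,
  forall i, i < s' vhead 0 -> s' adist i = 0 & 20 * (n - s' vhead 0) + 6 + r <= k'].
apply: (wp_while (Inv := Inv)) => [k' s' [[t0 t1 t2 tsrc told] le_n clr le_k']|]; last first.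
  by split=> //=; lia.
split; first by rewrite /=; lia.
rewrite /= t0; case: eqVneq => [done|more] /=.
  apply: post => //; first lia.
  by move=> u; apply: clr; have := ltn_ord u; lia.
apply: wp_seq; wp_assign; wp_assign; split=> //=; try lia.
by move=> i lt_i; case: eqP => // ne_i; apply: clr; lia.
Qed.

Definition scanned D u i := forall j, j < i ->
  D (nth u (adj u) j : nat) != 0 /\ D (nth u (adj u) j : nat) <= D (u : nat) + 1.

(** Each neighbour of [u] is paid from the share of [u]. Vertices are appended behind cell [h],
    which leaves the potential of the other vertices unchanged. *)
Lemma wp_scan src old u h s k r (Q : nat -> store -> Prop) :
    holds_input s src old -> s vhead 0 = h -> s vcur 0 = u -> s vedge 0 = offset u ->
    bfs_inv G src (s adist) (s aparent) (s aqueue) h (s vtail 0) ->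
    h < s vtail 0 -> s aqueue h = u ->
    50 * size (adj u) + 10 + 50 * work adj (s aqueue) h.+1 + r <= k ->
    (forall k' s', holds_input s' src old -> s' vhead 0 = h ->
      bfs_inv G src (s' adist) (s' aparent) (s' aqueue) h.+1 (s' vtail 0) ->
      50 * work adj (s' aqueue) h.+1 + r <= k' -> Q k' s') ->
  wp scan_prog s k Q.
Proof.
move=> inp sh su se inv lt_ht Qh le_k post.
pose Inv k' s' := exists i, [/\ [/\ holds_input s' src old, s' vhead 0 = h, s' vcur 0 = u,
    s' vedge 0 = offset u + i & i <= size (adj u)],
  bfs_inv G src (s' adist) (s' aparent) (s' aqueue) h (s' vtail 0),
  h < s' vtail 0 /\ s' aqueue h = u, scanned (s' adist) u i &
  50 * (size (adj u) - i) + 10 + 50 * work adj (s' aqueue) h.+1 + r <= k'].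
apply: (wp_while (Inv := Inv)); last first.
  by exists 0; split=> //; [split=> //; rewrite addn0 | rewrite subn0].
move=> k' s' [i [[[t0 t1 t2 tsrc told] th tu te le_i] tinv [lt_t tQ] scan le_k']].
split; first by rewrite /=; lia.
rewrite /= tu t1 te addn1 offsetS subnDl; case: eqVneq => [done|more] /=.
  apply: post => //; last lia.
  apply: bfs_inv_next tinv lt_t tQ _ => w Guw.
  have w_adj : w \in adj u by rewrite (adjG u).2.
  rewrite -(nth_index u w_adj); apply: scan.
  by have : index w (adj u) < size (adj u) by [rewrite index_mem]; lia.
have lt_i : i < size (adj u) by lia.
have lt_i' : i < size (adj u) by [].
pose w := nth u (adj u) i.
have Guw : G u w by have := mem_nth u lt_i; rewrite (adjG u).2.
apply: wp_seq; wp_assign; apply: wp_seq; wp_assign; rewrite t2 te entryE // -/w.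
apply: wp_if; first by rewrite /=; lia.
rewrite /=; case: eqVneq => [Dw|Dw] /=.
  have tinv' := bfs_inv_visit tinv lt_t tQ Guw Dw.
  do 3!(apply: wp_seq; wp_assign); wp_assign.
  have Du : s' adist u != 0.
    by have [v ev] := bfs_queue tinv lt_t; rewrite -ev tQ.
  have uw : (u == w :> nat) = false by apply/eqP => e; rewrite e Dw in Du.
  exists i.+1; split.
  - by split=> //=; rewrite ?te ?addn1 ?addnS //; lia.
  - by rewrite /= tu [s' 11 0 + 1]addn1; exact: tinv'.
  - by split=> /=; [lia | case: eqP => // ht; lia].
  - move=> j; rewrite ltnS leq_eqVlt /= tu uw => /orP[/eqP->|/scan].
      by rewrite -/w eqxx addn1.
    by case: (eqVneq (nth u (adj u) j : nat) w) => // _ _; rewrite addn1.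
  - have := work_upd adj (s' aqueue) (nat_of_ord w) lt_t.
    rewrite /upd /= => ->; lia.
apply: wp_skip; first lia.
exists i.+1; split=> //.
- by split=> //=; rewrite ?te ?addn1 ?addnS.
- move=> j; rewrite ltnS leq_eqVlt => /orP[/eqP->|/scan//] /=.
  rewrite -/w; split=> //.
  (* A neighbour visited earlier is in the queue, so the window bounds its value by that of the head
     plus 1. *)
  have [l lt_l <-] := bfs_visited tinv Dw.
  by rewrite -tQ; apply: bfs_window tinv _ lt_t lt_l.
- by move: le_k'; set X := work _ _ _; rewrite /=; lia.
Qed.

(** Processing a vertex releases 50 credits per neighbour and 50 more, which cover its scan and the
    overhead of the outer loop. *)
Lemma wp_bfs src old s k r (Q : nat -> store -> Prop) :
    holds_input s src old ->
    50 * (\sum_(u < n) (size (adj u) + 1)) + 20 * n + 100 + r <= k ->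
    (forall k' s', r <= k' -> holds_input s' src old ->
      bfs_result G src (s' adist) (s' aparent) (s' vfar 0) -> Q k' s') ->
  wp bfs_prog s k Q.
Proof.
move=> inp le_k post; apply: wp_seq.
apply: (wp_clear (r := 50 * (\sum_(u < n) (size (adj u) + 1)) + 80 + r) inp); first lia.
move=> k1 s1 le1 [t0 t1 t2 tsrc told] clr.
do 4!(apply: wp_seq; wp_assign); apply: wp_seq.
pose Inv k' s' := [/\ holds_input s' src old,
  bfs_inv G src (s' adist) (s' aparent) (s' aqueue) (s' vhead 0) (s' vtail 0) &
  50 * work adj (s' aqueue) (s' vhead 0) + 20 + r <= k'].
apply: (wp_while (Inv := Inv)) => [k' s' [inp' inv le_k']|]; last first.
  split=> //.
    apply: bfs_inv_start => //= w; rewrite tsrc val_eqE.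
    by case: eqVneq => // _; rewrite clr.
  by rewrite /= work0; lia.
split; first by rewrite /=; lia.
have le_ht := bfs_head inv.
rewrite /=; case: eqVneq => [done|more] /=.
  have ht : s' vhead 0 = s' vtail 0 by lia.
  wp_assign; apply: post; [lia | by case: inp'|].
  by rewrite subn1; apply: bfs_inv_result => //; rewrite /= -{1}ht.
have lt_ht : s' vhead 0 < s' vtail 0 by lia.
have [u Qh _] := bfs_queue inv lt_ht.
have uniqQ := uniq_mkseq_le lt_ht (bfs_uniq inv).
have workE := workS adj uniqQ Qh.
case: inp' => u0 u1 u2 usrc uold.
apply: wp_seq; wp_assign; apply: wp_seq; wp_assign; apply: wp_seq.
apply: (wp_scan (src := src) (old := old) (u := u) (h := s' vhead 0) (r := 30 + r)) => //=.
- by rewrite Qh u1.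
- by move: workE le_k'; set X := work _ _ _.+1; lia.
move=> k2 s2 [v0 v1 v2 v_src vold] vh inv2 le2; wp_assign; split=> //.
  by rewrite /= vh addn1.
by move: le2; rewrite /= vh addn1; set X := work _ _ _; lia.
Qed.

End Search.

(** * Mutually farthest vertices and their midpoint *)

Definition step_prog : com :=
  Seq (set_var vold (var vsrc)) (Seq (set_var vsrc (var vfar)) bfs_prog).

(* The test compares d(src,far) = e(src) with d(src,old) = e(old). *)
Definition search_prog : com :=
  Seq bfs_prog (Seq step_prog
    (While (Defs.Sub (Get adist (var vfar)) (Get adist (var vold))) step_prog)).

(* With L = d(src,old), and since the distance array is shifted by one, the two
   tests read 2 d(src,cur) > L and 2 d(src,cur) < L; when L is odd the walk stops
   just behind the edge whose middle is the midpoint. *)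
Definition walk_prog : com :=
  Seq (set_var vcur (var vold))
  (Seq (set_var vnbr (var vold))
  (Seq (While (Defs.Sub (Add (Get adist (var vcur)) (Get adist (var vcur)))
                        (Add (Get adist (var vold)) (Const 1)))
          (Seq (set_var vnbr (var vcur))
               (set_var vcur (Get aparent (var vcur)))))
       (If (Defs.Sub (Add (Get adist (var vold)) (Const 1))
                     (Add (Get adist (var vcur)) (Get adist (var vcur))))
          (Seq (set_var aout (var vcur))
          (Seq (Put aout (Const 1) (var vnbr))
          (Seq (Put aout (Const 2) (Const 1))
          (Seq (Put aout (Const 3) (Const 2))
               (If (Defs.Sub (var vcur) (var vnbr))
                  (Seq (set_var aout (var vnbr)) (Put aout (Const 1) (var vcur)))
                  Skip)))))
          (Seq (set_var aout (var vcur)) (Put aout (Const 1) (var vcur)))))).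

Section Midpoint.
Context (n : nat) (G : sgraph n) (adj : 'I_n -> seq 'I_n) (offset entry : nat -> nat).
Hypothesis Gconn : connected G.
Hypothesis adjG : adjacency_lists G adj.
Hypothesis offsetS : forall u : 'I_n, offset u.+1 = offset u + size (adj u).
Hypothesis entryE : forall (u : 'I_n) i,
  i < size (adj u) -> entry (offset u + i) = nth u (adj u) i.
Implicit Types (src old far x y u v w : 'I_n) (s : store) (k r : nat).

Local Notation bfs_time :=
  (50 * (\sum_(u < n) (size (adj u) + 1)) + 20 * n + 100).
Local Notation holds_input := (holds_input offset entry).

Lemma wp_step src old far s k r (Q : nat -> store -> Prop) :
    holds_input s src old -> s vfar 0 = far -> bfs_time + 10 + r <= k ->
    (forall k' s', r <= k' -> holds_input s' far src ->
      bfs_result G far (s' adist) (s' aparent) (s' vfar 0) -> Q k' s') ->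
  wp step_prog s k Q.
Proof.
move=> [s0 s1 s2 ssrc sold] sfar le_k post.
do 2!(apply: wp_seq; wp_assign).
apply: (wp_bfs Gconn adjG offsetS entryE (src := far) (old := src) (r := r)) post => //.
by move: le_k; set B := bfs_time; lia.
Qed.

Definition farthest u v := forall w, vdist G u w <= vdist G u v.

(** Two searches precede the loop. Whenever the test succeeds, [e(src)] exceeds [e(old)]; these
    values start at [d(v1,v2)] or above and never exceed [d(v1,v2) + K], so the body runs at most
    [K + 1] times. This makes [K + 3] searches in all. *)
Lemma wp_search K src old s k r (Q : nat -> store -> Prop) :
    (forall u v v' a b, farthest u v -> farthest v v' ->
      vdist G a b <= vdist G v v' + K) ->
    holds_input s src old -> (bfs_time + 20) * (K + 3) + 20 + r <= k ->
    (forall k' s' x y, r <= k' -> holds_input s' x y ->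
      (exists l, bfs_result G x (s' adist) (s' aparent) l) ->
      farthest x y -> farthest y x -> Q k' s') ->
  wp search_prog s k Q.
Proof.
move=> diam inp; set B := bfs_time => le_k post; apply: wp_seq.
apply: (wp_bfs Gconn adjG offsetS entryE (r := (B + 20) * (K + 2) + 20 + r) inp).
  by rewrite -/B; lia.
move=> k1 s1 le1 inp1 [_ _ [v1 far1 far_v1]]; apply: wp_seq.
apply: (wp_step (r := (B + 20) * (K + 1) + 10 + r) inp1 far1); first by rewrite -/B; lia.
move=> k2 s2 le2 inp2 res2.
have [v2 far2 far_v2] : exists2 v, s2 vfar 0 = nat_of_ord v & farthest v1 v.
  by case: res2.
pose M := vdist G v1 v2 + K.
have leM a b : vdist G a b <= M by apply: diam far_v1 far_v2.
(* Credits for further searches are required only if the test is about to succeed: when it fails,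
   [e(src)] need not have grown. *)
pose Inv k' s' := exists x y v : 'I_n, [/\ holds_input s' x y,
  bfs_result G x (s' adist) (s' aparent) (s' vfar 0),
  s' vfar 0 = v, [/\ farthest y x, farthest x v &
  vdist G x y < vdist G x v -> (B + 20) * (M.+1 - vdist G x v) + 10 + r <= k'] &
  10 + r <= k'].
apply: (wp_while (Inv := Inv)); last first.
  exists v1, src, v2; split=> //; last lia.
  by split=> // _; rewrite /M; have -> : (vdist G v1 v2 + K).+1 - vdist G v1 v2 = K + 1 by lia.
move=> k' s' [x [y [v [inp' res' farv [far_yx far_xv pot] le_k']]]].
split; first by rewrite /=; lia.
have [Dx _ _] := res'; have sold := input_old inp'.
rewrite /= sold farv !Dx subnDr; case: eqVneq => [done|more] /=.
  apply: (post _ _ x y) => //; first lia; first by eexists; apply: res'.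
  (* The test failed, so [y] is as far from [x] as the farthest vertex [v]. *)
  by move=> w; have := far_xv w; lia.
have lt_yv : vdist G x y < vdist G x v by lia.
have := leM x v; move/(_ lt_yv) in pot; move=> leMv.
have potE : (B + 20) * (M.+1 - vdist G x v) = (B + 20) * (M - vdist G x v) + (B + 20).
  by rewrite subSn // mulnS addnC.
apply: (wp_step (r := (B + 20) * (M - vdist G x v) + 10 + r) inp' farv).
  by rewrite -/B; lia.
move=> k3 s3 le3 inp3 res3; have [_ _ [v' farv' far_v']] := res3.
exists v, x, v'; split=> //; last by apply: leq_trans le3; rewrite -addnA leq_addl.
split=> // lt_v'; have le_v' := leM v v'.
apply: leq_trans le3; rewrite !leq_add2r leq_mul2l; apply/orP; right.
by rewrite (vdistC Gconn v x) in lt_v'; lia.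
Qed.

(** The middle is at distance 1/2 from both ends, so the direction of the edge only decides the
    order of cells 0 and 1. *)
Lemma outputs_edge_middle (R : realType) u v s : G u v ->
    s aout 0 = minn u v -> s aout 1 = maxn u v -> s aout 2 = 1 -> s aout 3 = 2 ->
  outputs s (edge_point G u v (1 / 2 : R)%R).
Proof.
move=> Guv out0 out1 out2 out3; case: edge_pointP => [||half0|H|H].
- by apply/andP; split; lra.
- by right.
- by move/eqP: half0; rewrite mul1r invr_eq0 pnatr_eq0.
- case/andP: (H) => lt_uv _; split; rewrite ?out2 ?out3 //.
    by rewrite out0 (minn_idPl (ltnW lt_uv)).
  by rewrite out1 (maxn_idPr (ltnW lt_uv)).
- case/andP: (H) => lt_vu _; split; rewrite ?out2 ?out3 //.
  + by rewrite out0 (minn_idPr (ltnW lt_vu)).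
  + by rewrite out1 (maxn_idPl (ltnW lt_vu)).
  + by lra.
Qed.

(** Parents lead from [y] towards [x] along a shortest path; the walk stops at the first vertex [u]
    with [2 d(x,u) <= L], which is the midpoint or lies half an edge behind it. *)
Lemma wp_walk (R : realType) x y (l : nat) s k (Q : nat -> store -> Prop) :
    holds_input s x y -> bfs_result G x (s adist) (s aparent) l ->
    50 * n + 100 <= k ->
    (forall k' s' (g : R -> gpoint R G), shortest_path (Vertex x) (Vertex y) g ->
      outputs s' (g ((vdist G x y)%:R / 2)%R) -> Q k' s') ->
  wp walk_prog s k Q.
Proof.
move=> [s0 s1 s2 ssrc sold] [Dx Px _] le_k post; set L := vdist G x y.
do 2!(apply: wp_seq; wp_assign); apply: wp_seq.
(* [p] is the part already walked, read from [u] back to [y]. The inequality says that the previous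
   vertex, at distance [d(x,u) + 1] from [x], was still beyond the middle. *)
pose Inv k' s' := exists (u v : 'I_n) p, [/\ [/\ s' adist = s adist, s' aparent = s aparent,
    s' vold 0 = y, s' vcur 0 = u & s' vnbr 0 = v],
  path G u p, last u p = y, size p + vdist G x u = L &
  (if p is v' :: _ then v' = v /\ L < 2 * (vdist G x u + 1) else True) /\
  50 * vdist G x u + 70 <= k'].
apply: (wp_while (Inv := Inv)); last first.
  exists y, y, [::]; split=> //; split=> //=.
  by have := vdist_leq_order G x y; lia.
move=> k' s' [u [v [p [[sD sP so su sv] pth lp sp [pv le_k']]]]].
split; first by rewrite /=; lia.
rewrite /= so su sD !Dx -/L; case: eqVneq => [done|more] /=; last first.
  have ux : u != x by apply: contra_neq more => ->; rewrite vdistxx; lia.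
  have [w [Pw Gwu dw]] := Px u ux.
  apply: wp_seq; wp_assign; wp_assign; exists w, u, (u :: p); split=> //=.
  - by split=> //; rewrite su sP.
  - by rewrite Gwu.
  - lia.
  - by split; [split=> //; lia | lia].
(* The unwalked half is never computed: any shortest path from [x] to [u] completes [p] to a
   shortest path from [x] to [y]. *)
have [p0 [pth0 lp0 sp0]] := vdist_path Gconn x u.
have path_xy : path G x (p0 ++ p) by rewrite cat_path pth0 lp0.
have geo : shortest_path (Vertex x) (Vertex y) (walk_point G x (p0 ++ p) : R -> gpoint R G).
  apply: walk_point_shortest => //; first by rewrite last_cat lp0.
  by rewrite size_cat sp0 addnC.
have nth_u : nth x (x :: p0 ++ p) (vdist G x u) = u.
  by rewrite -cat_cons nth_cat /= sp0 ltnS leqnn -sp0 -[size p0]/(size (x :: p0)).-1 nth_last.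
apply: wp_if; first by rewrite /=; lia.
rewrite /= so su sD !Dx -/L; case: eqVneq => [even|odd] /=.
  have L2 : (L%:R / 2 = (vdist G x u)%:R :> R)%R.
    have -> : L = vdist G x u + vdist G x u.
      by case: p pv sp {pth lp path_xy geo nth_u} => [|z p] /= pv sp; lia.
    by rewrite natrD; field.
  apply: wp_seq; wp_assign; wp_assign; apply: post geo _.
  by rewrite L2 walk_point_nat nth_u /= su.
(* Both tests together give [L = 2 d(x,u) + 1], so the midpoint is the middle of the edge from [u]
   to the previous vertex. *)
case: p pv sp pth lp path_xy geo nth_u => [|v' p] /= pv sp; first lia.
move=> /andP[Guv _] _ _ geo nth_u; case: pv => ? ?; subst v'.
have L2 : (L%:R / 2 = (vdist G x u)%:R + 1 / 2 :> R)%R.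
  have -> : L = (vdist G x u + vdist G x u + 1) by lia.
  by rewrite !natrD; field.
have nth_v : nth x (x :: p0 ++ v :: p) (vdist G x u).+1 = v.
  by rewrite /= nth_cat sp0 ltnn subnn.
have mid : walk_point G x (p0 ++ v :: p) (L%:R / 2 : R)%R = edge_point G u v (1 / 2)%R.
  have truncL : Num.truncn (L%:R / 2 : R)%R = vdist G x u.
    by apply: truncn_def; rewrite L2 -[in X in (_ < X)%R]natr1; apply/andP; split; lra.
  by rewrite /walk_point truncL nth_u nth_v L2 addrAC subrr add0r.
do 4!(apply: wp_seq; wp_assign).
apply: wp_if; first by rewrite /=; lia.
rewrite /= su sv; case: eqVneq => [le_uv|lt_vu] /=.
  apply: wp_skip; first lia.
  apply: post geo _; rewrite mid; apply: outputs_edge_middle => //=; rewrite ?su ?sv; lia.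
apply: wp_seq; wp_assign; wp_assign; apply: post geo _; rewrite mid.
by apply: outputs_edge_middle => //=; rewrite ?su ?sv; lia.
Qed.

End Midpoint.

(** * The total running time *)

Lemma sum_size_adj n (G : sgraph n) (adj : 'I_n -> seq 'I_n) :
  adjacency_lists G adj -> \sum_(u < n) size (adj u) = num_edges G + num_edges G.
Proof.
(* [fwd] counts every edge at its smaller end; with the sums exchanged, it is counted at its larger
   end. *)
move=> adjG; pose fwd := \sum_(u < n) \sum_(v < n) ((u < v) && G u v : nat).
have edgesE : num_edges G = fwd.
  rewrite /num_edges -sum1_card /fwd pair_bigA big_mkcond /=.
  by apply: eq_bigr => p _; rewrite inE; case: andP.
rewrite edgesE /fwd [in X in _ + X]exchange_big -big_split /=.
apply: eq_bigr => u _; rewrite -big_split /= -(card_uniqP (adjG u).1) -sum1_card big_mkcond.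
apply: eq_bigr => v _; rewrite (adjG u).2 -[v \in G u]/(G u v) (edge_sym G v).
case: ltngtP => [_|_|/val_inj->]; rewrite ?edge_irr //=.
by case: (G u v).
Qed.

Local Open Scope ring_scope.

Theorem theorem13 (R : realType) :
  exists (P : com) (C : nat),
  forall (n : nat) (G : sgraph n) (adj : 'I_n -> seq 'I_n) (delta : R),
    connected G -> adjacency_lists G adj -> hyperbolic G delta ->
    exists (t : nat) (s : store) (c : gpoint R G),
      [/\ exec P (input adj) t s,
          outputs s c,
          dominates (radius1 R G + delta) c &
          t%:R <= C%:R * ((2 * delta + 1) * (num_edges G + n)%:R)].
Proof.
(* With [X = m + n], the time is at most [290 X (2 delta + 3) + 170 X = 580 delta X + 1040 X], which
   1100 covers. *)
exists (Seq search_prog walk_prog), 1100%N => n G adj delta Gconn adjG [thin _].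
have delta_ge0 := insizes_ge0 Gconn thin.
(* Vertex distances are integers, so the excess [2 delta] may be rounded down to [K]. The program
   does not know [K], which only enters the analysis. *)
pose v0 := Ordinal Gconn.1; pose K := Num.truncn (2 * delta).
have leK : K%:R <= 2 * delta.
  by have /andP[] := truncn_itv (mulr_ge0 (ler0n R 2) delta_ge0).
have diam u v v' a b : farthest G u v -> farthest G v v' ->
    (vdist G a b <= vdist G v v' + K)%N.
  move=> far_v far_v'.
  wlog le_ba : a b / (vdist G v b <= vdist G v a)%N.
    move=> H; case/orP: (leq_total (vdist G v b) (vdist G v a)) => /H //.
    by rewrite (vdistC Gconn b).
  have := vdist_le_far Gconn thin far_v le_ba.
  have : (vdist G v a)%:R <= (vdist G v v')%:R :> R by rewrite ler_nat.
  move=> le_a le_ab; rewrite -leq_subLR truncn_ge_nat ?mulr_ge0 //.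
  have [le|/ltnW ge] := leqP (vdist G a b) (vdist G v v').
    by rewrite (eqP (_ : _ - _ == 0)%N) ?subn_eq0 // mulr_ge0.
  by rewrite natrB //; lra.
pose B := (50 * (\sum_(u < n) (size (adj u) + 1)) + 20 * n + 100)%N.
pose k := ((B + 20) * (K + 3) + 20 + (50 * n + 100))%N.
(* All other cells are initially 0, so the search starts at vertex 0. *)
have inp : holds_input (input adj 1) (input adj 2) (input adj) v0 v0 by [].
have [t [s [ex le_t [c [out_c dom_c]]]]] : wp (Seq search_prog walk_prog) (input adj) k
    (fun _ s => exists c : gpoint R G, outputs s c /\ dominates (radius1 R G + delta) c).
  apply: wp_seq; apply: (wp_search Gconn adjG (@input_offset _ adj) (@input_entry _ adj)
    (r := (50 * n + 100)%N) diam inp) => [//|k' s' x y le_k inp' [l res] far_xy far_yx].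
  apply: (wp_walk Gconn (R := R) inp' res le_k) => _ s'' g geo out_g.
  exists (g ((vdist G x y)%:R / 2)); split=> //.
  by apply: midpoint_dominates geo => //; rewrite (vdistC Gconn x).
exists t, s, c; split=> //.
have [X defX] : exists X, X = (num_edges G + n)%N by eexists.
have X_gt0 : (0 < X)%N by have := Gconn.1; lia.
have B_le : (B + 20 <= 290 * X)%N.
  by rewrite /B big_split /= (sum_size_adj adjG) sum_nat_const card_ord muln1; lia.
have t_le : (t <= 290 * X * (K + 3) + 170 * X)%N.
  apply: (leq_trans le_t); rewrite /k -addnA leq_add ?leq_mul2r ?B_le ?orbT //.
  by lia.
apply: (@le_trans _ _ (290 * X * (K + 3) + 170 * X)%:R); first by rewrite ler_nat.
rewrite -defX !(natrD, natrM).
(* The products are supplied by hand, which leaves a linear goal. *)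
have : 0 <= X%:R * (2 * delta - K%:R) by rewrite mulr_ge0 // subr_ge0.
have : 0 <= X%:R * delta by rewrite mulr_ge0.
have : 0 <= X%:R :> R by [].
by lra.
Qed.
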